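(* For $h$ on $\Omega$ put $$E_V=\int_\Omega h\,\omega^\varepsilon\,dx-\int_D h\,dx .$$ Let $1<p\le\infty$, $0<\varepsilon\le\varepsilon_0$ and $h\in L^p(D_\varepsilon;\omega^\varepsilon)$. Then there exists a constant $C>0$ independent of $\varepsilon$ and $h$ such that $$|E_V|\le C\,\varepsilon^{1-\frac1p}\,\|h\|_{L^p(\Gamma_\varepsilon;\omega^\varepsilon)}.$$ Moreover, if $p=1$ and $h\in L^1(\Omega)$, then $E_V\to0$ as $\varepsilon\to0^+$.
   Context: $D\subset\mathbb{R}^n$ is a bounded domain with boundary of class $C^{1,1}$, and $\Omega\subset\mathbb{R}^n$ is a domain with $\overline D\subset\Omega$. $d_D(x)=\mathrm{dist}(x,D)-\mathrm{dist}(x,\mathbb{R}^n\setminus D)$; $D_t=\{x: d_D(x)<t\}$; $\Gamma_\varepsilon=D_\varepsilon\setminus\overline{D_{-\varepsilon}}$. The number $\varepsilon_0>0$ is fixed and sufficiently small depending only on $D,\Omega$ (so that $d_D$ is $C^{1,1}$ and nearest-point projection onto $\partial D$ is single-valued on $\Gamma_{2\varepsilon_0}\subset\Omega$). $S:\mathbb{R}\to\mathbb{R}$ is a fixed function satisfying: (S1) $S$ is Lipschitz, $S(t)=t/|t|$ for $|t|\ge1$, $S'(t)>0$ for $|t|<1$, and $S(-t)=-S(t)$; (S2) there are $\zeta_1,\zeta_2,\alpha>0$ with $\zeta_1t^\alpha\le(1+S(t-1))/2\le\zeta_2t^\alpha$ for all $t\in(0,2)$. Put $\omega^\varepsilon(x)=\frac12\bigl(1+S(-d_D(x)/\varepsilon)\bigr)$,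 so $D_\varepsilon=\{\omega^\varepsilon>0\}$ (functions need only be defined on $D_\varepsilon$ in integrals against $\omega^\varepsilon$). For a measurable set $U\subset D_\varepsilon$ and $p<\infty$, $\|v\|^p_{L^p(U;\omega^\varepsilon)}=\int_U|v|^p\omega^\varepsilon dx$; for $p=\infty$, $L^\infty(U;\omega^\varepsilon)=L^\infty(U)$. Convention $1/\infty=0$. *)

(* Defs.v *)
From HB Require Import structures.
From mathcomp Require Import all_boot all_order all_algebra.
From mathcomp Require Import all_classical all_reals all_analysis.
Set Implicit Arguments.
Unset Strict Implicit.
Unset Printing Implicit Defensive.
Import Order.TTheory GRing.Theory Num.Theory.
Import numFieldNormedType.Exports.
Local Open Scope classical_set_scope.
Local Open Scope ring_scope.

(* R^n is 'rV[R]_n, with the dimension written n.+1 where n >= 1 is needed.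
   Topology, boundedness, differentiability and the Lipschitz property are those
   of the library's sup norm on 'rV[R]_n, which is equivalent to the Euclidean
   one; distances are Euclidean. *)

Section Lebesgue.
Context {R : realType} {n : nat}.
Implicit Types (ab : 'rV[R]_n.+1 * 'rV[R]_n.+1) (A : set 'rV[R]_n.+1).

Definition box ab : set 'rV[R]_n.+1 :=
  [set x | forall i, ab.1 ord0 i <= x ord0 i <= ab.2 ord0 i].

(* The truncation at 0 gives volume 0 to boxes that are empty because some lower
   bound exceeds the corresponding upper bound. *)
Definition box_volume ab : R :=
  \prod_(i < n.+1) Num.max 0 (ab.2 ord0 i - ab.1 ord0 i).

Definition lebesgue_outer A : \bar R :=
  ereal_inf [set (\sum_(0 <= k <oo) (box_volume (B k))%:E)%E
            | B in [set B : nat -> 'rV[R]_n.+1 * 'rV[R]_n.+1 |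
                      A `<=` \bigcup_k box (B k)]].

Local Open Scope ereal_scope.

Lemma box_volume_ge0 ab : 0 <= (box_volume ab)%:E.
Proof. by rewrite lee_fin; apply: prodr_ge0 => i _; rewrite le_max lexx. Qed.

Lemma lebesgue_outer_ge0 A : 0 <= lebesgue_outer A.
Proof.
apply: le_ereal_inf_tmp => _ [B _ <-].
by apply: nneseries_ge0 => k _ _; exact: box_volume_ge0.
Qed.

Lemma lebesgue_outer0 : lebesgue_outer set0 = 0.
Proof.
apply/eqP; rewrite eq_le lebesgue_outer_ge0 andbT.
apply: ereal_inf_lbound; exists (fun=> (0%R, 0%R)) => //=.
apply: eseries0 => k _ _; rewrite /box_volume big_ord_recl /=.
by rewrite subrr maxxx mul0r.
Qed.

Lemma le_lebesgue_outer :
  {homo lebesgue_outer : A B / (A `<=` B)%classic >-> A <= B}.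
Proof.
move=> A B AB; apply: ereal_inf_le_tmp => _ [C BC <-].
by exists C => //=; apply: subset_trans BC.
Qed.

Lemma lebesgue_outer_sigma_subadditive : sigma_subadditive lebesgue_outer.
Proof.
move=> A; have [[i ioo]|] := pselect (exists i, lebesgue_outer (A i) = +oo).
  rewrite (eseries_pinfty _ _ ioo) ?leey// => k _.
  by rewrite -ltNye (lt_le_trans _ (lebesgue_outer_ge0 _)).
rewrite -forallNE => Aoo; apply/lee_addgt0Pr => e e0.
rewrite (le_trans _ (epsilon_trick _ _ (ltW e0)))//; last first.
  by move=> k; exact: lebesgue_outer_ge0.
have [G PG] : {G : nat -> nat -> _ & forall k,
    A k `<=` \bigcup_j box (G k j) /\
    \sum_(0 <= j <oo) (box_volume (G k j))%:E <=
      lebesgue_outer (A k) + (e / (2 ^ k.+1)%:R)%:E}.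
  apply: (@choice _ _ (fun k (B : nat -> 'rV[R]_n.+1 * 'rV[R]_n.+1) =>
    A k `<=` \bigcup_j box (B j) /\ \sum_(0 <= j <oo) (box_volume (B j))%:E <=
      lebesgue_outer (A k) + (e / (2 ^ k.+1)%:R)%:E)) => k.
  have fAk : lebesgue_outer (A k) \is a fin_num.
    by rewrite ge0_fin_numE ?lebesgue_outer_ge0// ltey; apply/eqP; exact: Aoo.
  have ek : (0 < e / (2 ^ k.+1)%:R)%R by rewrite divr_gt0.
  have [_ [B AB <-] /ltW BA] := lb_ereal_inf_adherent ek fAk.
  by exists B.
pose vG ij := (box_volume (uncurry G ij))%:E.
have vG_ge0 ij : 0 <= vG ij by exact: box_volume_ge0.
apply: (@le_trans _ _ (\esum_(ij in setT) vG ij)).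
  apply: ereal_inf_lbound => /=.
  have /card_esym/ppcard_eqP[f] := card_nat2.
  exists (uncurry G \o f).
    move=> t [i _] /((PG i).1) [j _ Gij]; exists (f^-1%FUN (i, j)) => //=.
    by rewrite invK ?inE.
  rewrite -(esum_pred_image vG _ xpredT) ?[fun=> _]set_true//.
  by rewrite image_eq.
rewrite (_ : esum _ _ = \sum_(i <oo) \sum_(j <oo) (box_volume (G i j))%:E).
  apply: lee_lim.
  - apply: is_cvg_nneseries => k *.
    by apply: nneseries_ge0 => m *; exact: (vG_ge0 (k, m)).
  - apply: is_cvg_nneseries => k *; apply: adde_ge0.
      exact: lebesgue_outer_ge0.
    by rewrite lee_fin divr_ge0 ?ltW.
  - by near=> k; apply: lee_sum => i _; exact: (PG i).2.
pose J : nat -> set (nat * nat) := fun i => [set (i, j) | j in setT].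
rewrite (_ : setT = \bigcup_k J k); last first.
  by rewrite predeqE => -[a b]; split => // _; exists a => //; exists b.
rewrite esum_bigcupT /=; last 2 first.
- apply/trivIsetP => i j _ _ ij.
  rewrite predeqE => -[k m] /=; split => //= -[] [_] _ [<-{k} _].
  by move=> [m' _] [] /esym/eqP; rewrite (negbTE ij).
- by move=> k; exact: vG_ge0.
rewrite -(image_id [set: nat]) -fun_true esum_pred_image//; last first.
  by move=> k _; exact: esum_ge0.
apply: eq_eseriesr => /= j _.
rewrite -(esum_pred_image vG (pair j) predT)//=; last first.
  by move=> ? ? _ _; exact: (@can_inj _ _ _ snd).
by congr esum; rewrite predeqE => -[a b]; split; move=> [i _ <-]; exists i.
Unshelve. all: by end_near. Qed.

HB.instance Definition _ := isOuterMeasure.Build R 'rV[R]_n.+1 lebesgue_outer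
  lebesgue_outer0 lebesgue_outer_ge0 le_lebesgue_outer
  lebesgue_outer_sigma_subadditive.

End Lebesgue.

Definition lebesgue_outer_measure (R : realType) (n : nat) :
  {outer_measure set 'rV[R]_n.+1 -> \bar R} := lebesgue_outer.

(* The measurable sets of lebesgue_type R n are the Lebesgue measurable subsets
   of R^(n+1), in the sense of Caratheodory. *)
Notation lebesgue_type R n := (caratheodory_type (lebesgue_outer_measure R n)).

Definition lebesgue {R : realType} {n : nat} :
    {measure set (lebesgue_type R n) -> \bar R} :=
  (lebesgue_outer_measure R n : set (lebesgue_type R n) -> \bar R).

Section Geometry.
Context {R : realType}.

Definition enorm {n} (x : 'rV[R]_n) : R := Num.sqrt (\sum_i x ord0 i ^+ 2).

Definition dist {n} (x : 'rV[R]_n) (A : set 'rV[R]_n) : R :=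
  inf [set enorm (x - a) | a in A].

Definition signed_dist {n} (D : set 'rV[R]_n) (x : 'rV[R]_n) : R :=
  dist x D - dist x (~` D).

Definition sublevel {n} (D : set 'rV[R]_n) (t : R) : set 'rV[R]_n :=
  [set x | signed_dist D x < t].

Definition tube {n} (D : set 'rV[R]_n) (eps : R) : set 'rV[R]_n :=
  sublevel D eps `\` closure (sublevel D (- eps)).

Definition boundary {n} (D : set 'rV[R]_n) : set 'rV[R]_n :=
  closure D `\` interior D.

Definition domain {n} (D : set 'rV[R]_n) : Prop :=
  [/\ open D, connected D & D !=set0].

Definition gradient {n} (f : 'rV[R]_n -> R) (x : 'rV[R]_n) : 'rV[R]_n :=
  \row_i 'D_(delta_mx ord0 i) f x.

Definition C11_on {n} (U : set 'rV[R]_n) (f : 'rV[R]_n -> R) : Prop :=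
  (forall x, U x -> differentiable f x) /\ [lipschitz gradient f x | x in U].

(* Near each boundary point x0, after a rigid motion y = (x - x0) Q, the set D is
   the part of a ball lying strictly above the graph of a C^{1,1} function of all
   coordinates but the last. *)
Definition C11_boundary {n} (D : set 'rV[R]_n.+1) : Prop :=
  forall x0, boundary D x0 ->
  exists (r : R) (Q : 'M[R]_n.+1) (g : 'rV[R]_n -> R),
    [/\ 0 < r, Q *m Q^T = 1%:M, C11_on setT g &
        forall x, enorm (x - x0) < r ->
          let y := (x - x0) *m Q in
          D x <-> g (col' ord_max y) < y ord0 ord_max].

(* The smallness requirement on eps0: on the tube of radius 2 eps0, which lies in
   Omega, the signed distance is C^{1,1} and nearest boundary points are unique. *)
Definition small_radius {n} (D Omega : set 'rV[R]_n) (eps0 : R) : Prop :=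
  [/\ 0 < eps0,
      tube D (2 * eps0) `<=` Omega,
      C11_on (tube D (2 * eps0)) (signed_dist D) &
      forall x, tube D (2 * eps0) x ->
        exists! z, boundary D z /\ enorm (x - z) = dist x (boundary D)].

End Geometry.

Section Regularization.
Context {R : realType}.

Definition profile_S1 (S : R -> R) : Prop :=
  [/\ lipschitz S,
      forall t, 1 <= `|t| -> S t = t / `|t|,
      forall t : R, `|t| < 1 -> derivable S t 1 /\ 0 < 'D_1 S t &
      forall t, S (- t) = - S t].

Definition profile_S2 (S : R -> R) : Prop :=
  exists zeta1 zeta2 alpha : R,
    [/\ 0 < zeta1, 0 < zeta2, 0 < alpha &
        forall t, 0 < t < 2 ->
          zeta1 * t `^ alpha <= (1 + S (t - 1)) / 2 <= zeta2 * t `^ alpha].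

Definition omega {n} (S : R -> R) (D : set 'rV[R]_n) (eps : R)
    (x : 'rV[R]_n) : R :=
  (1 + S (- signed_dist D x / eps)) / 2.

(* For p = +oo the weight is ignored: v \_ U is v extended by 0 outside U. *)
Definition weighted_norm {n} (p : \bar R) (U : set 'rV[R]_n.+1)
    (w v : 'rV[R]_n.+1 -> R) : \bar R :=
  (if p is q%:E then
     (\int[lebesgue]_(x in U) (`|v x| `^ q * w x)%:E) `^ q^-1
   else 'N[lebesgue]_p [EFin \o (v \_ U : lebesgue_type R n -> R)])%E.

Definition in_weighted_Lp {n} (p : \bar R) (U : set 'rV[R]_n.+1)
    (w v : 'rV[R]_n.+1 -> R) : Prop :=
  measurable_fun (U : set (lebesgue_type R n)) v /\
  (weighted_norm p U w v < +oo)%E.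

(* The integrand of the first integral vanishes outside sublevel D eps, so only
   the values of h on that set matter there. *)
Definition E_V {n} (S : R -> R) (D Omega : set 'rV[R]_n.+1) (eps : R)
    (h : 'rV[R]_n.+1 -> R) : \bar R :=
  (\int[lebesgue]_(x in Omega) (h x * omega S D eps x)%:E
   - \int[lebesgue]_(x in D) (h x)%:E)%E.

End Regularization.

(* Main.v *)
Require Import Defs.
From mathcomp Require Import all_boot all_order all_algebra finmap.
From mathcomp Require Import all_classical all_reals all_analysis.
From mathcomp Require Import measurable_realfun ess_sup_inf ring lra.
Import Order.TTheory GRing.Theory Num.Theory.
Import numFieldNormedType.Exports.
Local Open Scope classical_set_scope.
Local Open Scope ring_scope.

(** The weight [omega] differs from the indicator function of [D] only inside
    the tube of radius [eps], and there by at most [omega] itself: outside [D]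
    the difference is [omega], and inside [D] it is [1 - omega], where
    [omega >= 1/2] because [S] is nonnegative on nonnegative numbers
    ([omega_sub_indic]). Hence [|E_V|] is at most the integral of [|h| omega]
    over the tube ([E_V_le]). Hoelder's inequality for the measure [omega dx],
    in which the total mass of the tube is at most its volume, bounds this by
    the weighted norm of [h] times the volume of the tube to the power [1 - 1/p]
    ([weighted_norm_hoelder]).

    It remains to see that the tube has volume O(eps) ([lebesgue_tube_le]). A
    point of the tube is joined to a point on the other side of the boundary by
    a segment shorter than [2 eps], and this segment meets the boundary; so the
    tube lies in the closed [2 eps]-thickening of the boundary. The boundary is
    compact and locally contained in a Lipschitz image of a cube of one dimension
    less ([C11_boundary_patch]); a grid of mesh [eps] in that cube has O(eps^-n)
    points, and each of them accounts for a box of volume O(eps^(n+1)) in the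
    thickening ([thin_lipschitz_image]). As the measure is an infimum over
    coverings by boxes, this bounds the volume of the thickening.

    For [p = 1] the integral of [|h|] over the tube tends to 0 with the volume of
    the tube, by absolute continuity of the integral. *)

(** * The sup norm and the Euclidean norm *)

Lemma normv_le {R : realType} {m n} (x : 'M[R]_(m, n)) (r : R) : 0 <= r ->
  (forall i j, `|x i j| <= r) -> `|x| <= r.
Proof.
move=> r0 xr; rewrite /Num.norm/= mx_normrE.
by apply/bigmax_leP; split => // -[i j] _ /=.
Qed.

Lemma coord_le_normv {R : realType} {m n} (x : 'M[R]_(m, n)) i j :
  `|x i j| <= `|x|.
Proof.
rewrite [leRHS]/Num.norm/= mx_normrE.
exact: (le_bigmax _ (fun ij => `|x ij.1 ij.2|) (i, j)).
Qed.

Lemma coord_le_enorm {R : realType} {n} (x : 'rV[R]_n) i : `|x 0 i| <= enorm x.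
Proof.
rewrite -sqrtr_sqr ler_wsqrtr// (bigD1 i)//= lerDl.
by apply: sumr_ge0 => j _; rewrite sqr_ge0.
Qed.

Lemma normv_le_enorm {R : realType} {n} (x : 'rV[R]_n) : `|x| <= enorm x.
Proof.
apply: normv_le => [|i j]; first exact: sqrtr_ge0.
by rewrite (ord1 i) coord_le_enorm.
Qed.

Lemma enormZ {R : realType} {n} (c : R) (x : 'rV[R]_n) :
  enorm (c *: x) = `|c| * enorm x.
Proof.
rewrite /enorm -sqrtr_sqr -sqrtrM ?sqr_ge0// mulr_sumr.
by congr Num.sqrt; apply: eq_bigr => i _; rewrite mxE exprMn.
Qed.

Lemma enormN {R : realType} {n} (x : 'rV[R]_n) : enorm (- x) = enorm x.
Proof. by rewrite -scaleN1r enormZ normrN1 mul1r. Qed.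

Lemma enorm0 {R : realType} {n} : enorm (0 : 'rV[R]_n) = 0.
Proof. by rewrite -(scale0r 0) enormZ normr0 mul0r. Qed.

Lemma open_enorm_ball {R : realType} {n} (a : 'rV[R]_n) (r : R) :
  open [set x | enorm (x - a) < r].
Proof.
have c i : continuous (fun y : 'rV[R]_n => (y - a) 0 i).
  move=> y; have -> : (fun y : 'rV[R]_n => (y - a) 0 i) = (fun y => y 0 i - a 0 i).
    by apply/funext => z; rewrite !mxE.
  by apply: continuousB; [exact: coord_continuous|exact: cst_continuous].
rewrite -[X in open X]/((fun x => enorm (x - a)) @^-1` [set t | t < r]).
apply: open_comp; last exact: open_lt.
move=> x _.
apply: (@continuous_comp _ _ _
  (fun y : 'rV[R]_n => \sum_i (y - a) 0 i ^+ 2)); last first.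
  exact: sqrt_continuous.
apply: (cvg_big add_continuous) => [|i _]; first exact: (nbhs_filter x).
by rewrite expr2; exact: (cvgM (c i x) (c i x)).
Qed.

Lemma mulmx_norm_le {R : realType} {m p} (A : 'M[R]_(m, p)) :
  exists2 K : R, 0 <= K & forall v : 'rV[R]_m, `|v *m A| <= K * `|v|.
Proof.
exists (m%:R * `|A|) => [|v]; first by rewrite mulr_ge0.
apply: normv_le => [|i j]; first by rewrite !mulr_ge0.
rewrite mxE (le_trans (ler_norm_sum _ _ _))//.
apply: (@le_trans _ _ (\sum_(k < m) `|A| * `|v|)); last first.
  by rewrite sumr_const card_ord -mulrA [m%:R * _]mulr_natl.
by apply: ler_sum => k _; rewrite normrM mulrC ler_pM// coord_le_normv.
Qed.

(** * Lipschitz functions *)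

Lemma lipschitz_const {R : realType} {V W : normedModType R} (f : V -> W) :
  lipschitz f -> exists2 k : R, 0 <= k & forall y z, `|f y - f z| <= k * `|y - z|.
Proof.
move=> [k0 [_ lf]]; exists (Num.max 0 k0 + 1).
  by rewrite addr_ge0// le_max lexx.
move=> y z; apply: (lf _ _ (y, z)) => //.
by rewrite (@le_lt_trans _ _ (Num.max 0 k0)) ?ltrDl// le_max lexx orbT.
Qed.

Lemma lipschitz_at_continuous {R : realType} {V W : normedModType R}
    (f : V -> W) (z : V) (K : R) :
  0 <= K -> (forall x, `|f x - f z| <= K * `|x - z|) -> {for z, continuous f}.
Proof.
move=> K0 fK; apply/cvgrPdist_lt => e e0.
have K1 : 0 < K + 1 by lra.
near=> x; rewrite distrC (le_lt_trans (fK x))//.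
apply: (@le_lt_trans _ _ ((K + 1) * `|x - z|)); first by rewrite ler_wpM2r//; lra.
rewrite mulrC -ltr_pdivlMr// distrC; near: x.
by apply: cvgr_dist_lt => //; exact: divr_gt0.
Unshelve. all: by end_near. Qed.

Lemma derive_gradient {R : realType} {n} (g : 'rV[R]_n -> R) (z v : 'rV[R]_n) :
  differentiable g z -> 'D_v g z = \sum_i v 0 i * gradient g z 0 i.
Proof.
move=> dg; rewrite deriveE// [in LHS](row_sum_delta v) linear_sum.
by apply: eq_bigr => i _; rewrite linearZ /= !mxE deriveE.
Qed.

(** A Lipschitz gradient is bounded on balls, and the mean value theorem along the
    segment from [z] to [y] turns this bound into a Lipschitz constant. *)
Lemma C11_lipschitz {R : realType} {n} (g : 'rV[R]_n -> R) (r : R) :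
  C11_on setT g -> exists2 L : R, 0 <= L &
  forall y z, `|y| <= r -> `|z| <= r -> `|g y - g z| <= L * `|y - z|.
Proof.
move=> [dg /lipschitz_const[k k_ge0 lg]].
exists (n%:R * (`|gradient g 0| + k * `|r|)).
  by rewrite mulr_ge0// addr_ge0// mulr_ge0.
move=> y z yr zr.
pose phi (t : R) := g (z + t *: (y - z)).
have dphi (t : R) : is_derive t 1 phi ('D_(y - z) g (z + t *: (y - z))).
  (* the difference quotients of phi at t and of g along y - z coincide *)
  have e : (fun h : R => h^-1 *: (phi (h *: 1 + t) - phi t)) =
      (fun h : R => h^-1 *: (g (h *: (y - z) + (z + t *: (y - z))) -
                             g (z + t *: (y - z)))).
    apply/funext => h; rewrite /phi; congr (_ *: (g _ - _)).
    have -> : h *: 1 + t = h + t by rewrite [h *: 1]mulr1.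
    by rewrite scalerDl addrCA.
  have /diff_derivable D := dg (z + t *: (y - z)) I.
  apply: DeriveDef.
    by rewrite /derivable; move: (D (y - z)); rewrite /derivable /= e.
  by rewrite /derive /= e.
have cphi : {within `[0, 1], continuous phi}.
  apply: continuous_subspaceT => t; apply: differentiable_continuous.
  by apply/derivable1_diffP; exact: ex_derive.
have [c c01] := MVT_segment ler01 (fun t _ => dphi t) cphi.
rewrite /phi scale1r scale0r addr0 subrKC subr0 mulr1 => ->.
have {}c01 : 0 <= c <= 1 by move: c01; rewrite in_itv.
set w := z + c *: (y - z).
have wr : `|w| <= r.
  have -> : w = (1 - c) *: z + c *: y.
    by rewrite /w scalerBl scale1r scalerBr addrA addrAC.
  rewrite (le_trans (ler_normD _ _))// !normrZ !ger0_norm; [|lra..].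
  by nra.
rewrite derive_gradient; last exact: dg.
apply: (le_trans (ler_norm_sum _ _ _)).
apply: (@le_trans _ _
  (\sum_(i < n) (`|gradient g 0| + k * `|r|) * `|y - z|)); last first.
  by rewrite sumr_const card_ord -mulrA [n%:R * _]mulr_natl.
apply: ler_sum => i _; rewrite normrM mulrC.
apply: ler_pM => //; last exact: coord_le_normv.
apply: le_trans (coord_le_normv _ _ _) _.
rewrite -[X in `|X|](subrK (gradient g 0)) addrC.
rewrite (le_trans (ler_normD _ _))// lerD2l (le_trans (lg _ _))// subr0.
by rewrite ler_wpM2l// (le_trans wr)// ler_norm.
Qed.

(** * Box coverings and Lebesgue measurability of open sets *)

Section outer.
Context {R : realType} {n : nat}.
Implicit Types (ab : 'rV[R]_n.+1 * 'rV[R]_n.+1) (A : set 'rV[R]_n.+1).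

Lemma lebesgue_outer_box ab : (lebesgue_outer (box ab) <= (box_volume ab)%:E)%E.
Proof.
apply: ereal_inf_lbound => /=.
exists (fun k => if k == 0%N then ab else (0, 0)).
  by move=> x abx; exists 0%N.
rewrite (nneseries_split 0 1)/=; last by move=> k _; exact: box_volume_ge0.
rewrite big_nat1 /= eseries0 ?adde0//.
move=> [|k] //= _ _; rewrite /box_volume big_ord_recl /=.
by rewrite subrr maxxx mul0r.
Qed.

(** Counting form of subadditivity: a finite family is indexed by its cardinal,
    because outer measures are subadditive along sequences. *)
Lemma lebesgue_outer_bigcup_fin (I : finType) (F : I -> set 'rV[R]_n.+1) (c : R) :
  (forall i, lebesgue_outer (F i) <= c%:E)%E ->
  (lebesgue_outer (\bigcup_i F i) <= (#|I|%:R * c)%:E)%E.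
Proof.
move=> Fc.
pose G k := if insub k is Some j then F (@enum_val I xpredT j) else set0.
have -> : \bigcup_i F i = \big[setU/set0]_(k < #|I|) G k.
  rewrite -bigcup_mkord; apply/seteqP; split => x.
    move=> [i _ Fix]; exists (enum_rank i) => //=.
    by rewrite /G valK enum_rankK.
  by move=> [k /= kI]; rewrite /G insubT => Gx; exists (enum_val (Sub k kI)).
have := outer_measure_subadditive (lebesgue_outer_measure R n) G #|I|.
move=> /le_trans; apply.
apply: (@le_trans _ _ (\sum_(i < #|I|) c%:E)%E).
  by apply: lee_sum => i _; rewrite /G valK; exact: Fc.
by rewrite sumEFin sumr_const card_ord mulr_natl.
Qed.

(** The hyperplane [x_i = c] cuts a box into two boxes of the same total volume.
    Thanks to the truncation in [box_volume] this holds also when the hyperplane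
    misses the box or the box is empty. *)
Lemma box_volume_split ab i (c : R) :
  box_volume (ab.1, \row_j (if j == i then Num.min (ab.2 0 i) c else ab.2 0 j)) +
  box_volume (\row_j (if j == i then Num.max (ab.1 0 i) c else ab.1 0 j), ab.2)
  = box_volume ab.
Proof.
rewrite /box_volume [in RHS](bigD1 i)//= (bigD1 i)//= [X in _ + X](bigD1 i)//=.
rewrite !mxE eqxx.
set V := \prod_(j < n.+1 | j != i) Num.max 0 (ab.2 0 j - ab.1 0 j).
have -> : \prod_(j < n.+1 | j != i) Num.max 0
    ((\row_k (if k == i then Num.min (ab.2 0 i) c else ab.2 0 k)) 0 j - ab.1 0 j)
    = V.
  by apply: eq_bigr => j /negPf ji; rewrite mxE ji.
have -> : \prod_(j < n.+1 | j != i) Num.max 0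
    (ab.2 0 j - (\row_k (if k == i then Num.max (ab.1 0 i) c else ab.1 0 k)) 0 j)
    = V.
  by apply: eq_bigr => j /negPf ji; rewrite mxE ji.
rewrite -mulrDl; congr (_ * _).
move: (ab.1 0 i) (ab.2 0 i) => a b; clear.
have [bc|cb] := leP b c; have [ac|ca] := leP a c.
- by rewrite (@max_l _ _ 0 (b - c)) ?addr0//; lra.
- by rewrite !(max_l (x := 0))// ?addr0//; lra.
- by rewrite !(max_r (x := 0)); lra.
- by rewrite (@max_l _ _ 0 (c - a)) ?add0r//; lra.
Qed.

(** Cutting every box of a covering of [X] by the hyperplane gives coverings of
    the two parts of [X] without changing the total volume, which is
    Caratheodory's criterion. *)
Lemma measurable_halfspace i (c : R) :
  measurable ([set x : lebesgue_type R n | (x : 'rV[R]_n.+1) 0 i <= c]).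
Proof.
apply: le_caratheodory_measurable => X; apply: le_ereal_inf_tmp => _ [B XB <-].
pose lo ab : 'rV[R]_n.+1 * 'rV[R]_n.+1 :=
  (ab.1, \row_j (if j == i then Num.min (ab.2 0 i) c else ab.2 0 j)).
pose up ab : 'rV[R]_n.+1 * 'rV[R]_n.+1 :=
  (\row_j (if j == i then Num.max (ab.1 0 i) c else ab.1 0 j), ab.2).
have -> : (\sum_(0 <= k <oo) (box_volume (B k))%:E =
    \sum_(0 <= k <oo) (box_volume (lo (B k)))%:E +
    \sum_(0 <= k <oo) (box_volume (up (B k)))%:E)%E.
  rewrite -nneseriesD; [|by move=> *; exact: box_volume_ge0..].
  by apply: eq_eseriesr => k _; rewrite -EFinD box_volume_split.
apply: leeD; apply: ereal_inf_lbound => /=.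
- exists (lo \o B) => //= x [/XB [k _ Bx] xc]; exists k => // j /=.
  have := Bx j; rewrite !mxE; case: eqP => [->|_ //] /andP[-> /= xb].
  by rewrite le_min xb.
- exists (up \o B) => //= x [/XB [k _ Bx] /negP]; rewrite -ltNge => xc.
  exists k => // j /=.
  have := Bx j; rewrite !mxE; case: eqP => [->|_ //] /andP[ax -> /=].
  by rewrite ge_max ax (ltW xc).
Qed.

(** An open set is the union of the half-open boxes with rational corners that it
    contains, and such a box is a finite intersection of differences of
    half-spaces. *)
Lemma open_measurable_lebesgue (U : set 'rV[R]_n.+1) :
  open U -> measurable (U : set (lebesgue_type R n)).
Proof.
move=> oU.
pose J (q : 'rV[rat]_n.+1 * 'rV[rat]_n.+1) : set 'rV[R]_n.+1 :=
  [set x | forall i, ratr (q.1 0 i) < x 0 i <= ratr (q.2 0 i)].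
have mJ q : measurable (J q : set (lebesgue_type R n)).
  have -> : J q = \bigcap_(i in [set: 'I_n.+1])
      ([set x : 'rV[R]_n.+1 | x 0 i <= ratr (q.2 0 i)] `\`
       [set x : 'rV[R]_n.+1 | x 0 i <= ratr (q.1 0 i)]).
    apply/seteqP; split => x /= Jx i; last first.
      have [/= -> /negP] := Jx i I.
      by rewrite -ltNge => ->.
    move=> _; have /andP[q1 q2] := Jx i; split => //=.
    by apply/negP; rewrite -ltNge.
  apply: fin_bigcap_measurable => //.
  move=> i _; apply: measurableD; exact: measurable_halfspace.
have -> : U = \bigcup_q (if pselect (J q `<=` U) then J q else set0).
  apply/seteqP; split => x; last first.
    by move=> [q _]; case: pselect => // JU /JU.
  move=> Ux; have /nbhs_ballP[e /= e0 xeU] : nbhs x U by exact: open_nbhs_nbhs.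
  have q1P i : exists q : rat, x 0 i - e < ratr q < x 0 i.
    have [|q] := @rat_in_itvoo R (x 0 i - e) (x 0 i); first by lra.
    by rewrite in_itv /= => ?; exists q.
  have q2P i : exists q : rat, x 0 i < ratr q < x 0 i + e.
    have [|q] := @rat_in_itvoo R (x 0 i) (x 0 i + e); first by lra.
    by rewrite in_itv /= => ?; exists q.
  have [q1 {}q1P] := choice q1P; have [q2 {}q2P] := choice q2P.
  exists (\row_i q1 i, \row_i q2 i) => //.
  case: pselect => [_ i /=|[]].
    by rewrite !mxE; have /andP[_ ->] := q1P i; have /andP[/ltW -> _] := q2P i.
  move=> y Jy; apply: xeU; split => // i j; rewrite (ord1 i).
  have := Jy j; rewrite /= !mxE; have := q1P j; have := q2P j.
  rewrite /ball/= ltr_norml => /andP[? ?] /andP[? ?] /andP[? ?].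
  by apply/andP; split; lra.
apply: countable_bigcupT_measurable; first exact: countableP.
by move=> q; case: pselect => a //=; exact: mJ.
Qed.

Lemma closed_measurable_lebesgue (U : set 'rV[R]_n.+1) :
  closed U -> measurable (U : set (lebesgue_type R n)).
Proof.
by move=> cU; rewrite -(setCK U);
  exact/measurableC/open_measurable_lebesgue/closed_openC.
Qed.

End outer.

(** * Sets whose thickenings have volume O(d) *)

Section thin.
Context {R : realType} {n : nat}.
Implicit Types (A B : set 'rV[R]_n.+1).

Definition thickening A (d : R) : set 'rV[R]_n.+1 :=
  [set x | exists2 a, A a & `|x - a| <= d].

(** The set has finite upper Minkowski content of codimension one. The constant
    may depend on the bound [M] on the radius, so that large radii are allowed for
    bounded sets. *)
Definition thin A : Prop := forall M : R, 0 < M -> exists2 C : R, 0 <= C &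
  forall d, 0 < d <= M -> (lebesgue_outer (thickening A d) <= (C * d)%:E)%E.

Lemma thin0 : thin set0.
Proof.
move=> M M0; exists 0 => // d _; rewrite mul0r.
by rewrite (_ : thickening _ _ = set0) ?lebesgue_outer0// -subset0 => x [].
Qed.

Lemma thin_subset A B : A `<=` B -> thin B -> thin A.
Proof.
move=> AB tB M /tB[C C0 CB]; exists C => // d /CB; apply: le_trans.
by apply: le_lebesgue_outer => x [a /AB]; exists a.
Qed.

Lemma thinU A B : thin A -> thin B -> thin (A `|` B).
Proof.
move=> tA tB M M0; have [C C0 CA] := tA _ M0; have [C' C'0 CB] := tB _ M0.
exists (C + C'); first exact: addr_ge0.
move=> d dM; rewrite mulrDl EFinD; apply: le_trans (leeD (CA _ dM) (CB _ dM)).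
apply: le_trans (outer_measureU2 (lebesgue_outer_measure R n) _ _).
by apply: le_lebesgue_outer => x [a [] ?]; [left|right]; exists a.
Qed.

Lemma thin_bigcup_fset (I : choiceType) (s : {fset I})
    (F : I -> set 'rV[R]_n.+1) : {in s, forall i, thin (F i)} ->
  thin (\bigcup_(i in [set` s]) F i).
Proof.
move=> tF; rewrite bigcup_fset big_seq.
by elim/big_ind : _ => [|? ?|i]; [exact: thin0|exact: thinU|exact: tF].
Qed.

Lemma thin_compact A : compact A ->
  (forall a, A a -> exists2 e : R, 0 < e & thin (A `&` ball a e)) -> thin A.
Proof.
rewrite compact_cover => cA tA.
have /choice[e eP] : forall a, exists e : R, 0 < e /\ (A a -> thin (A `&` ball a e)).
  move=> a; have [/tA[e e0 te]|nA] := pselect (A a); first by exists e.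
  by exists 1.
have [||s sA As] := cA _ A (fun a => (ball a (e a))^°).
- by move=> a _; exact: open_interior.
- move=> a Aa; exists a => //; apply: nbhsx_ballx; exact: (eP a).1.
apply: (@thin_subset _ (\bigcup_(a in [set` s]) (A `&` ball a (e a)))).
  by move=> x Ax; have [a sa /interior_subset] := As _ Ax; exists a.
by apply: thin_bigcup_fset => a /sA/set_mem/(eP a).2.
Qed.

(** The lattice of mesh [d] meets the cube in O(d^-n) points, and the
    [d]-thickening of the image is covered by as many boxes of half-side
    [(1 + L) * d], centred at the images of lattice points: every point of the
    cube lies within [d] of the lattice point below it. *)
Lemma thin_lipschitz_image (f : 'rV[R]_n -> 'rV[R]_n.+1) (r L : R) :
  0 <= r -> 0 <= L ->
  (forall y z, `|y| <= r -> `|z| <= r -> `|f y - f z| <= L * `|y - z|) ->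
  thin (f @` [set y | `|y| <= r]).
Proof.
move=> r0 L0 fL M M0.
exists ((2 * r + M) ^+ n * (2 * (1 + L)) ^+ n.+1).
  by rewrite mulr_ge0// exprn_ge0//; lra.
move=> d /andP[d0 dM].
pose N := Num.truncn (2 * r / d).
pose c (k : {ffun 'I_n -> 'I_N.+1}) : 'rV[R]_n := \row_i (- r + d * (k i)%:R).
pose b k : 'rV[R]_n.+1 * 'rV[R]_n.+1 :=
  (f (c k) - const_mx ((1 + L) * d), f (c k) + const_mx ((1 + L) * d)).
have thb : thickening (f @` [set y | `|y| <= r]) d `<=` \bigcup_k box (b k).
  move=> x [_ [y /= yr <-] xd].
  have yri i : - r <= y 0 i <= r.
    by rewrite -ler_norml (le_trans _ yr)// coord_le_normv.
  have yN i : (Num.truncn ((y 0 i + r) / d)%R < N.+1)%N.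
    rewrite ltnS; apply: le_truncn; rewrite ler_pM2r ?invr_gt0//.
    by have /andP[? ?] := yri i; lra.
  (* the lattice point below y, counted from the corner (-r, ..., -r) *)
  pose k : {ffun 'I_n -> 'I_N.+1} := [ffun i => Ordinal (yN i)].
  have ck i : y 0 i - d <= c k 0 i <= y 0 i.
    rewrite !mxE ffunE /=.
    have : 0 <= (y 0 i + r) / d.
      by rewrite divr_ge0 ?(ltW d0)//; have /andP[? ?] := yri i; lra.
    move=> /truncn_itv/andP[].
    rewrite ler_pdivlMr// ltr_pdivrMr// -natr1 => ? ?; apply/andP; split; lra.
  exists k => //= i; rewrite !mxE.
  have ycd : `|y - c k| <= d.
    apply: normv_le (ltW d0) _ => j1 j; rewrite (ord1 j1) !mxE.
    by have /andP[] := ck j; rewrite mxE ler_norml => ? ?; apply/andP; split; lra.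
  have cr : `|c k| <= r.
    apply: normv_le r0 _ => j1 j; rewrite (ord1 j1) ler_norml.
    have -> : - r <= c k 0 j by rewrite mxE lerDl mulr_ge0// ltW.
    by have /andP[? ?] := ck j; have /andP[? ?] := yri j; lra.
  have := le_trans (coord_le_normv _ ord0 i) xd.
  have := le_trans (coord_le_normv _ ord0 i) (fL _ _ yr cr).
  rewrite !mxE !ler_norml => /andP[? ?] /andP[? ?].
  have : L * `|y - c k| <= L * d by rewrite ler_wpM2l.
  by move=> ?; apply/andP; split; lra.
apply: le_trans (le_lebesgue_outer thb) _.
have vb k : box_volume (b k) = (2 * (1 + L) * d) ^+ n.+1.
  rewrite /box_volume (eq_bigr (fun=> 2 * (1 + L) * d)) ?prodr_const ?card_ord//.
  move=> i _; rewrite !mxE.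
  rewrite [X in Num.max _ X](_ : _ = 2 * (1 + L) * d); last by ring.
  by apply: max_r; rewrite !mulr_ge0//; lra.
have obk k : (lebesgue_outer (box (b k)) <= ((2 * (1 + L) * d) ^+ n.+1)%:E)%E.
  by rewrite -(vb k); exact: lebesgue_outer_box.
apply: le_trans (lebesgue_outer_bigcup_fin _ _ _ obk) _.
rewrite lee_fin card_ffun !card_ord natrX exprMn (exprSr d) !mulrA.
rewrite ler_pM2r// mulrAC ler_pM2r; last by rewrite exprn_gt0//; lra.
rewrite -exprMn lerXn2r ?nnegrE; [by []|by rewrite mulr_ge0// ltW|lra|].
have : 0 <= 2 * r / d by rewrite divr_ge0 ?(ltW d0)//; lra.
by move=> /truncn_itv/andP[+ _]; rewrite -/N ler_pdivlMr// -natr1; lra.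
Qed.

End thin.

(** * The boundary of a bounded C^{1,1} domain *)

(** In the rotated coordinates [y = (x - x0) *m Q] a boundary point lies on the
    graph of [g]: above the graph it would be interior to [D], and below it, by
    continuity of [g], it would have a neighbourhood without points of [D]. The
    graph is the image of a cube under the locally Lipschitz map
    [y' |-> (y', g y')], followed by the inverse rotation. *)
Lemma C11_boundary_patch {R : realType} {n} (D : set 'rV[R]_n.+1)
    (x0 : 'rV[R]_n.+1) (r : R) (Q : 'M[R]_n.+1) (g : 'rV[R]_n -> R) :
  open D -> 0 < r -> Q *m Q^T = 1%:M -> C11_on setT g ->
  (forall x, enorm (x - x0) < r -> let y := (x - x0) *m Q in
     D x <-> g (col' ord_max y) < y ord0 ord_max) ->
  thin (boundary D `&` [set x | enorm (x - x0) < r]).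
Proof.
move=> oD r0 QQ gC Dg.
have [K K0 QK] := mulmx_norm_le Q.
have [K' K'0 QK'] := mulmx_norm_le Q^T.
have Kr : 0 <= K * r by rewrite mulr_ge0// ltW.
have [L L0 gL] := C11_lipschitz g (K * r) gC.
pose lift_graph (y : 'rV[R]_n) : 'rV[R]_n.+1 :=
  \row_j (if unlift ord_max j is Some k then y 0 k else g y).
have sub : boundary D `&` [set x | enorm (x - x0) < r] `<=`
    (fun y => x0 + lift_graph y *m Q^T) @` [set y | `|y| <= K * r].
  move=> z [[cDz]]; rewrite (interior_id _).1// => nDz /= zr.
  set y := (z - x0) *m Q.
  exists (col' ord_max y) => /=.
    apply: normv_le => // i j; rewrite mxE.
    rewrite (le_trans (coord_le_normv _ _ _))// (le_trans (QK _))//.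
    by rewrite ler_wpM2l// (le_trans (normv_le_enorm _))// ltW.
  have gy : g (col' ord_max y) = y 0 ord_max.
    apply/eqP; rewrite eq_le !leNgt; apply/andP; split; apply/negP; last first.
      by move/(Dg z zr).2.
    move=> ygt.
    (* the height of the graph over x, positive on the side away from D *)
    pose phi (x : 'rV[R]_n.+1) :=
      g (col' ord_max ((x - x0) *m Q)) - ((x - x0) *m Q) 0 ord_max.
    have xz i j x : ((x - x0) *m Q) i j - ((z - x0) *m Q) i j = ((x - z) *m Q) i j.
      have -> : x - z = (x - x0) - (z - x0) by rewrite opprB addrA subrK.
      by rewrite [in RHS]mulmxBl [RHS]mxE; congr (_ + _); rewrite [RHS]mxE.
    have clast : {for z, continuous
        (fun x : 'rV[R]_n.+1 => ((x - x0) *m Q) 0 ord_max)}.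
      apply: (lipschitz_at_continuous _ _ K) => // x.
      by rewrite xz (le_trans _ (QK _))// coord_le_normv.
    have cinit : {for z, continuous
        (fun x : 'rV[R]_n.+1 => col' ord_max ((x - x0) *m Q))}.
      apply: (lipschitz_at_continuous _ _ K) => // x.
      apply: normv_le => [|i j]; first by rewrite mulr_ge0.
      have -> : (col' ord_max ((x - x0) *m Q) - col' ord_max ((z - x0) *m Q)) i j =
          ((x - x0) *m Q) i (lift ord_max j) - ((z - x0) *m Q) i (lift ord_max j).
        by rewrite !mxE.
      by rewrite xz (le_trans _ (QK _))// coord_le_normv.
    have cg : {for col' ord_max y, continuous g}.
      by apply: differentiable_continuous; exact: gC.1.
    have cphi : {for z, continuous phi}.
      exact: continuousB (continuous_comp cinit cg) clast.
    have phiz : 0 < phi z by rewrite subr_gt0.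
    have nphi : \forall x \near z, 0 < phi x.
      exact: (cvgr_gt _ cphi).
    have nr : \forall x \near z, enorm (x - x0) < r.
      by apply: (open_nbhs_nbhs (conj (open_enorm_ball x0 r) _)).
    have [x [Dx [xr]]] := cDz _ (filterI nr nphi).
    by rewrite /= subr_gt0 => /ltW; rewrite leNgt => /negP; apply; exact/(Dg x xr).1.
  have -> : lift_graph (col' ord_max y) = y.
    apply/rowP => j; rewrite mxE; case: unliftP => [k ->|->]; first by rewrite mxE.
    exact: gy.
  by rewrite /y -mulmxA QQ mulmx1 subrKC.
apply: thin_subset sub _.
apply: (thin_lipschitz_image _ _ (K' * Num.max 1 L)) => //.
  by rewrite mulr_ge0// le_max ler01.
move=> y z yr zr.
rewrite opprD addrACA subrr add0r -mulmxBl (le_trans (QK' _))//.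
rewrite -mulrA ler_wpM2l//.
have mL : 1 <= Num.max 1 L by rewrite le_max lexx.
apply: normv_le => [|i j]; first by rewrite mulr_ge0// (le_trans ler01).
rewrite (ord1 i) !mxE; case: unliftP => [k _|_].
  rewrite (@le_trans _ _ `|y - z|)//; last by rewrite ler_peMl.
  by have := coord_le_normv (y - z) 0 k; rewrite !mxE.
by rewrite (le_trans (gL _ _ yr zr))// ler_wpM2r// le_max lexx orbT.
Qed.

Lemma bounded_closure {R : realType} {n} (D : set 'rV[R]_n) :
  bounded_set D -> bounded_set (closure D).
Proof.
move=> [M [Mr DM]]; exists M; split => // x Mx.
apply: (@subset_trans _ (closure [set y : 'rV[R]_n | `|y| <= x])).
  by apply: closure_subset => y Dy; exact: DM.
rewrite -(closure_id _).1//.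
rewrite -[X in closed X]/((fun y : 'rV[R]_n => `|y|) @^-1` [set t | t <= x]).
apply: preimage_closed.
  by move=> y _; exact: norm_continuous.
exact: closed_le.
Qed.

Lemma thin_C11_boundary {R : realType} {n} (D : set 'rV[R]_n.+1) :
  open D -> bounded_set D -> C11_boundary D -> thin (boundary D).
Proof.
move=> oD bD CD; apply: thin_compact.
  apply: bounded_closed_compact.
    apply: (@sub_boundedr _ _ _ _ (globally (closure D))).
      2: exact: bounded_closure.
    by move=> P /= cP x [/cP].
  rewrite /boundary setDE; apply: closedI; first exact: closed_closure.
  exact/open_closedC/open_interior.
move=> x0 /CD[r [Q [g [r0 QQ gC Dg]]]].
have : nbhs x0 [set x | enorm (x - x0) < r].
  by apply: open_nbhs_nbhs; split; [exact: open_enorm_ball|rewrite /= subrr enorm0].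
move=> /nbhs_ballP[e /= e0 er]; exists e => //.
apply: thin_subset (C11_boundary_patch D x0 r Q g oD r0 QQ gC Dg).
by move=> x [? /er].
Qed.

(** * Signed distance and tubes *)

Section distance.
Context {R : realType} {n : nat}.
Implicit Types (A : set 'rV[R]_n) (x : 'rV[R]_n).

Let dist_lbound A x : lbound [set enorm (x - a) | a in A] 0.
Proof. by move=> _ [a _ <-]; exact: sqrtr_ge0. Qed.

Lemma dist_ltP A x (t : R) : A !=set0 ->
  (dist x A < t) <-> (exists2 a, A a & enorm (x - a) < t).
Proof.
move=> [a0 Aa0]; split.
  have : [set enorm (x - a) | a in A] !=set0 by exists (enorm (x - a0)), a0.
  by move=> /inf_lt/[apply] -[_ [a Aa <-] at_]; exists a.
move=> [a Aa]; apply: le_lt_trans; apply: ge_inf; last by exists a.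
by exists 0; exact: dist_lbound.
Qed.

Lemma dist_ge0 A x : A !=set0 -> 0 <= dist x A.
Proof.
move=> A0; rewrite leNgt; apply/negP => /(dist_ltP _ _ _ A0)[a _].
by rewrite ltNge sqrtr_ge0.
Qed.

Lemma dist_mem A x : A x -> dist x A = 0.
Proof.
move=> Ax; apply/eqP; rewrite eq_le dist_ge0 ?andbT; last by exists x.
apply: ge_inf; first by exists 0; exact: dist_lbound.
by exists x => //; rewrite subrr enorm0.
Qed.

(** A union of balls centred in [A]. *)
Lemma open_dist_lt A (t : R) : A !=set0 -> open [set x | dist x A < t].
Proof.
move=> A0.
rewrite (_ : [set _ | _] = \bigcup_(a in A) [set x | enorm (x - a) < t]).
  by apply: bigcup_open => a _; exact: open_enorm_ball.
by apply/seteqP; split=> x; [move/(dist_ltP _ _ _ A0)|move=> ?; apply/dist_ltP].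
Qed.

End distance.

Section signed_distance.
Context {R : realType} {n : nat} (D : set 'rV[R]_n).
Hypotheses (oD : open D) (D0 : D !=set0) (CD0 : ~` D !=set0).
Implicit Types x a z : 'rV[R]_n.

Lemma signed_dist_in x : D x -> signed_dist D x = - dist x (~` D).
Proof. by move=> Dx; rewrite /signed_dist dist_mem// sub0r. Qed.

Lemma signed_dist_out x : ~ D x -> signed_dist D x = dist x D.
Proof. by move=> Dx; rewrite /signed_dist [X in _ - X]dist_mem// subr0. Qed.

Lemma signed_dist_le0 x : D x -> signed_dist D x <= 0.
Proof. by move=> Dx; rewrite signed_dist_in// oppr_le0 dist_ge0. Qed.

Lemma signed_dist_ge0 x : ~ D x -> 0 <= signed_dist D x.
Proof. by move=> Dx; rewrite signed_dist_out// dist_ge0. Qed.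

(** The set where [dist x (~` D) < e] is open and disjoint from
    [sublevel D (- e)], hence also from its closure; so a point of the closure is
    at distance at least [e > 0] from the complement of [D]. *)
Lemma closure_sublevel_neg (e : R) : 0 < e ->
  closure (sublevel D (- e)) `<=` [set x | D x /\ signed_dist D x <= - e].
Proof.
move=> e0 x cx.
have {cx} : e <= dist x (~` D).
  rewrite leNgt; apply/negP => xe.
  have [y [ye]] := cx _ (open_nbhs_nbhs (conj (open_dist_lt _ e CD0) xe)).
  move: ye; rewrite /sublevel /=.
  have [Dy|nDy] := pselect (D y).
    by rewrite signed_dist_in// ltrN2 => /lt_trans h /h; rewrite ltxx.
  by have := signed_dist_ge0 y nDy; lra.
move=> ex /=.
have Dx : D x by apply: contrapT => nDx; move: ex; rewrite dist_mem// leNgt e0.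
by split=> //; rewrite signed_dist_in// lerN2.
Qed.

(** The boundary point is the first point of the segment from [x] to [a] outside
    [D]: it is not in [D] because [D] is open, and it is a limit of earlier points
    of the segment, which lie in [D]. *)
Lemma segment_boundary x a : D x -> ~ D a ->
  exists2 t : R, 0 <= t <= 1 & boundary D (x + t *: (a - x)).
Proof.
move=> Dx nDa; pose gam (t : R) := x + t *: (a - x).
pose E := [set t : R | 0 <= t <= 1 /\ ~ D (gam t)].
have E1 : E 1 by split; [rewrite ler01 lexx|rewrite /gam scale1r subrKC].
have lE : lbound E 0 by move=> t [/andP[]].
have hE : has_inf E by split; [exists 1|exists 0].
pose s := inf E.
have s0 : 0 <= s by apply: lb_le_inf; [exists 1|].
have s1 : s <= 1 by apply: ge_inf; [exists 0|].
have cgam : {for s, continuous gam}.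
  apply: (@lipschitz_at_continuous _ _ _ gam s `|a - x|) => // t.
  by rewrite /gam opprD addrACA subrr add0r -scalerBl normrZ mulrC.
have near_s (B : set 'rV[R]_n) : nbhs (gam s) B ->
    exists2 e : R, 0 < e & forall t, `|s - t| < e -> B (gam t).
  by move=> /cgam/nbhs_ballP[e /= e0 eB]; exists e => // t /eB.
have nDs : ~ D (gam s).
  move=> Ds; have [e e0 eD] := near_s D (open_nbhs_nbhs (conj oD Ds)).
  have [t Et ts] := inf_adherent e0 hE.
  have st : s <= t by apply: ge_inf => //; exists 0.
  by apply: Et.2; apply: eD; rewrite distrC ger0_norm; rewrite -/s in ts; lra.
exists s; first by rewrite s0.
split; last by rewrite (interior_id _).1.
have {}s0 : 0 < s.
  rewrite lt_neqAle s0 andbT; apply/negP => /eqP s0'.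
  by apply: nDs; rewrite /gam -s0' scale0r addr0.
move=> B /near_s[e e0 eB].
pose t := s - Num.min e s / 2.
have [m0 me ms] : [/\ 0 < Num.min e s, Num.min e s <= e & Num.min e s <= s].
  by rewrite lt_min e0 s0 !ge_min !lexx orbT.
exists (gam t); split; last first.
  by apply: eB; rewrite /t opprB addrC subrK ger0_norm; lra.
apply: contrapT => nDt.
have : E t by split=> //; rewrite /t; apply/andP; split; lra.
move=> Et; have : s <= t by apply: ge_inf => //; exists 0.
by rewrite /t; lra.
Qed.

End signed_distance.

(** Inside [D] the segment goes to a point of the complement at distance less than
    [2 * e]; outside [D] it comes from a point of [D] at distance less than [e].
    The factor 2 leaves room for a point of the complement that only nearly attains
    a distance equal to [e]. *)
Lemma tube_thickening {R : realType} {n} (D : set 'rV[R]_n.+1) (e : R) :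
  open D -> D !=set0 -> ~` D !=set0 -> 0 < e ->
  tube D e `<=` thickening (boundary D) (2 * e).
Proof.
move=> oD D0 CD0 e0 x [xe nx].
have {}nx : - e <= signed_dist D x.
  by rewrite leNgt; apply/negP => ?; apply: nx; exact: subset_closure.
have shrink (v : 'rV[R]_n.+1) (t : R) : 0 <= t <= 1 -> enorm v < 2 * e ->
    `|t *: v| <= 2 * e.
  move=> /andP[t0 t1] /ltW ve; rewrite normrZ ger0_norm//.
  rewrite (@le_trans _ _ (1 * `|v|)) ?ler_wpM2r// mul1r.
  exact: le_trans (normv_le_enorm _) ve.
have [Dx|nDx] := pselect (D x).
  move: nx; rewrite signed_dist_in// lerN2 => nx.
  have /(dist_ltP _ _ _ CD0)[a nDa xa] : dist x (~` D) < 2 * e by lra.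
  have [t t01 bt] := segment_boundary D oD x a Dx nDa.
  exists (x + t *: (a - x)) => //.
  by rewrite opprD addrA subrr add0r normrN; apply: shrink => //;
    rewrite -enormN opprB.
move: xe; rewrite /sublevel/= signed_dist_out// => xe.
have /(dist_ltP _ _ _ D0)[a Da xa] : dist x D < 2 * e by lra.
have [t t01 bt] := segment_boundary D oD a x Da nDx.
exists (a + t *: (x - a)) => //.
rewrite opprD addrA -[X in X - _]scale1r -scalerBl; apply: shrink => //.
by move: t01 => /andP[? ?]; apply/andP; split; lra.
Qed.

(** The volume estimate behind the power of [eps] in the theorem. *)
Lemma lebesgue_tube_le {R : realType} {n} (D : set 'rV[R]_n.+1) (e0 : R) :
  open D -> bounded_set D -> C11_boundary D -> D !=set0 -> ~` D !=set0 -> 0 < e0 ->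
  exists2 C : R, 0 < C & forall e, 0 < e <= e0 ->
    (lebesgue_outer (tube D e) <= (C * e)%:E)%E.
Proof.
move=> oD bD CD D0 CD0 e00.
have [|C C0 tC] := thin_C11_boundary D oD bD CD (2 * e0); first by lra.
exists (2 * C + 1) => [|e /andP[epos ee0]]; first by lra.
apply: (@le_trans _ _ (C * (2 * e))%:E).
  apply: le_trans (tC _ _); last by apply/andP; split; lra.
  exact/le_lebesgue_outer/tube_thickening.
by rewrite lee_fin; nra.
Qed.

Lemma bounded_setC {R : realType} {n} (D : set 'rV[R]_n.+1) :
  bounded_set D -> ~` D !=set0.
Proof.
move=> [M [_ DM]]; exists (const_mx (Num.max 0 (M + 1) + 1)) => Dx.
have h : 0 <= Num.max 0 (M + 1) by rewrite le_max lexx.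
have : M < Num.max 0 (M + 1) + 1 / 2.
  by rewrite (@lt_le_trans _ _ (M + 1))// ?ltrDl// ler_wpDr// le_max lexx orbT.
move=> /DM/(_ _ Dx)/= /(le_trans (coord_le_normv _ 0 0)).
by rewrite mxE ger0_norm; lra.
Qed.

Lemma lebesgue_outer_bounded {R : realType} {n} (A : set 'rV[R]_n.+1) :
  bounded_set A -> (lebesgue_outer A < +oo)%E.
Proof.
move=> [M [_ AM]].
pose b : 'rV[R]_n.+1 * 'rV[R]_n.+1 := (const_mx (- (M + 1)), const_mx (M + 1)).
apply: (@le_lt_trans _ _ (box_volume b)%:E); last exact: ltry.
apply: le_trans (lebesgue_outer_box b); apply: le_lebesgue_outer => x Ax i.
rewrite !mxE -ler_norml (le_trans (coord_le_normv _ _ _))//.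
by apply: AM Ax; rewrite ltrDl.
Qed.

(** Makes the volume of [sublevel D eps] finite, so that functions in its weighted
    L^p space are integrable against the weight. *)
Lemma bounded_sublevel {R : realType} {n} (D : set 'rV[R]_n) (t : R) :
  D !=set0 -> ~` D !=set0 -> 0 < t -> bounded_set D -> bounded_set (sublevel D t).
Proof.
move=> D0 CD0 t0 [M [Mr DM]]; exists (M + t); split; first exact: num_real.
move=> K MK x /= xt.
have [Dx|nDx] := pselect (D x); first by apply: DM Dx; lra.
move: xt; rewrite /sublevel/= signed_dist_out// => /(dist_ltP _ _ _ D0)[a Da xa].
rewrite -(subrK a x) (le_trans (ler_normD _ _))//.
have := normv_le_enorm (x - a); have : `|a| <= K - t by apply: DM Da; lra.
by lra.
Qed.

(** * The profile and the weight *)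

Section profile.
Context {R : realType} (S : R -> R).
Hypotheses (S1 : profile_S1 S) (S2 : profile_S2 S).

Lemma profile_continuous : continuous S.
Proof.
have [/lipschitz_const[k k0 Sk] _ _ _] := S1.
by move=> t; apply: (@lipschitz_at_continuous _ _ _ S t k).
Qed.

Lemma profile_eq1 t : 1 <= t -> S t = 1.
Proof.
have [_ St _ _] := S1 => t1; have t0 : 0 < t by lra.
by rewrite St ger0_norm ?divff ?gt_eqF// ltW.
Qed.

Lemma profile_opp t : S (- t) = - S t.
Proof. by have [_ _ _] := S1. Qed.

Lemma profile_eqN1 t : t <= -1 -> S t = -1.
Proof. by move=> t1; rewrite -[t]opprK profile_opp profile_eq1//; lra. Qed.

(** An odd function vanishes at 0, and [S] has positive derivative up to 1. *)
Lemma profile_ge0 t : 0 <= t -> 0 <= S t.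
Proof.
have [_ _ dS _] := S1; move=> t0.
have [t1|t1] := leP 1 t; first by rewrite profile_eq1.
have S0 : S 0 = 0 by have := profile_opp 0; rewrite oppr0; lra.
have D u : u \in `]0, t[ -> is_derive u 1 S ('D_1 S u).
  rewrite in_itv/= => /andP[u0 ut]; apply: DeriveDef => //; apply: (dS _ _).1.
  by rewrite ger0_norm; lra.
have [|c] := MVT_segment t0 D; first exact/continuous_subspaceT/profile_continuous.
rewrite in_itv/= S0 !subr0 => /andP[c0 ct] ->.
by rewrite mulr_ge0// ltW//; apply: (dS _ _).2; rewrite ger0_norm//; lra.
Qed.

(** On (-1, 1) this is the positivity of the lower bound in the growth
    condition. *)
Lemma profile_geN1 t : - 1 <= S t.
Proof.
have [t1|t1] := leP t (-1); first by rewrite profile_eqN1.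
have [t2|t2] := leP 1 t; first by rewrite profile_eq1//; lra.
have [z1 [z2 [al [z10 _ _ St]]]] := S2.
have /andP[+ _] :
    z1 * (t + 1) `^ al <= (1 + S (t + 1 - 1)) / 2 <= z2 * (t + 1) `^ al.
  by apply: St; apply/andP; split; lra.
rewrite addrK; have : 0 <= z1 * (t + 1) `^ al by rewrite mulr_ge0 ?powR_ge0// ltW.
by lra.
Qed.

Lemma profile_le1 t : S t <= 1.
Proof. by rewrite -[t]opprK profile_opp; have := profile_geN1 (- t); lra. Qed.

Lemma omega_ge0 {n} (D : set 'rV[R]_n) (e : R) x : 0 <= omega S D e x.
Proof. by rewrite /omega; have := profile_geN1 (- signed_dist D x / e); lra. Qed.

Lemma omega_le1 {n} (D : set 'rV[R]_n) (e : R) x : omega S D e x <= 1.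
Proof. by rewrite /omega; have := profile_le1 (- signed_dist D x / e); lra. Qed.

Lemma omega_eq0 {n} (D : set 'rV[R]_n) (e : R) x : 0 < e ->
  ~ sublevel D e x -> omega S D e x = 0.
Proof.
move=> e0 /negP; rewrite -leNgt => ex; rewrite /omega profile_eqN1 ?subrr ?mul0r//.
by rewrite mulNr lerN2 ler_pdivlMr// mul1r.
Qed.

(** In the tube the difference is [omega] outside [D] and
    [1 - omega <= 1 / 2 <= omega] inside [D]. A point off the tube is either outside
    [sublevel D e], where both functions vanish, or in the closure of
    [sublevel D (- e)], where both are 1. *)
Lemma omega_sub_indic {n} (D : set 'rV[R]_n) (e : R) x : D !=set0 -> ~` D !=set0 ->
  0 < e -> `|omega S D e x - \1_D x| <= omega S D e x * \1_(tube D e) x.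
Proof.
move=> D0 CD0 e0.
have w0 := omega_ge0 D e x; have w1 := omega_le1 D e x.
have [tx|ntx] := pselect (tube D e x).
  rewrite [\1_(tube D e) x]indicE mem_set// mulr1 indicE.
  have [Dx|nDx] := pselect (D x); last first.
    by rewrite memNset// subr0 ger0_norm.
  rewrite mem_set//= distrC ger0_norm ?subr_ge0//.
  suff : 0 <= S (- signed_dist D x / e) by rewrite /omega; lra.
  by apply: profile_ge0; rewrite divr_ge0 ?(ltW e0)// oppr_ge0 signed_dist_le0.
rewrite [\1_(tube D e) x]indicE memNset// mulr0 normr_le0 subr_eq0 indicE.
have [xe|/(omega_eq0 D e x e0) wx] := pselect (sublevel D e x); last first.
  rewrite memNset//; first by apply/eqP.
  move=> Dx; suff : 1 / 2 <= omega S D e x by lra.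
  suff : 0 <= S (- signed_dist D x / e) by rewrite /omega; lra.
  by apply: profile_ge0; rewrite divr_ge0 ?(ltW e0)// oppr_ge0 signed_dist_le0.
have /(closure_sublevel_neg D D0 CD0 e e0)[Dx dx] : closure (sublevel D (- e)) x.
  by apply: contrapT => ncx; exact: ntx.
rewrite mem_set//= /omega profile_eq1 ?divff//.
by rewrite ler_pdivlMr// mul1r lerNr.
Qed.

End profile.

Section measurability.
Context {R : realType} {n : nat} (D : set 'rV[R]_n.+1).
Hypotheses (D0 : D !=set0) (CD0 : ~` D !=set0).

(** The distance function is upper semicontinuous, its sublevel sets being open. *)
Lemma measurable_dist (A : set 'rV[R]_n.+1) : A !=set0 ->
  measurable_fun setT ((fun x => dist x A) : lebesgue_type R n -> R).
Proof.
move=> A0; apply: (measurability _ (RGenInftyO.measurableE R)) => // _ [_ [t ->] <-].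
rewrite setTI (_ : _ @^-1` _ = [set x | dist x A < t]).
  exact/open_measurable_lebesgue/open_dist_lt.
by apply/seteqP; split => x; rewrite /= in_itv.
Qed.

Lemma measurable_signed_dist :
  measurable_fun setT (signed_dist D : lebesgue_type R n -> R).
Proof. by apply: measurable_funB; exact: measurable_dist. Qed.

Lemma measurable_omega (S : R -> R) (e : R) : continuous S ->
  measurable_fun setT (omega S D e : lebesgue_type R n -> R).
Proof.
move=> cS; rewrite /omega.
have mN : measurable_fun [set: lebesgue_type R n] (\- signed_dist D).
  exact: measurable_funN measurable_signed_dist.
have mS : measurable_fun [set: lebesgue_type R n]
    (S \o (fun x => - signed_dist D x / e)).
  apply: (measurableT_comp (continuous_measurable_fun cS)).
  exact: measurable_funM mN (measurable_cst _).
exact: measurable_funM (measurable_funD (measurable_cst _) mS) (measurable_cst _).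
Qed.

Lemma measurable_sublevel (t : R) :
  measurable (sublevel D t : set (lebesgue_type R n)).
Proof.
rewrite (_ : sublevel D t = setT `&` signed_dist D @^-1` `]-oo, t[).
  by apply: measurable_signed_dist => //; exact: measurable_itv.
by rewrite setTI; apply/seteqP; split => x; rewrite /= in_itv.
Qed.

Lemma measurable_tube (e : R) : measurable (tube D e : set (lebesgue_type R n)).
Proof.
apply: measurableD; first exact: measurable_sublevel.
exact/closed_measurable_lebesgue/closed_closure.
Qed.

End measurability.

(** * Integrals of weighted functions *)

Section core.
Context d {T : measurableType d} {R : realType} (mu : {measure set T -> \bar R}).
Implicit Types (G D Om : set T) (k w : T -> R).
Local Open Scope ereal_scope.

(** Hoelder's inequality for [k * w ^ (1/q)] and the indicator of [G], combined with
    [w <= w ^ (1/q)], which holds because [0 <= w <= 1]. *)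
Lemma hoelder_weighted G k w (q : R) : measurable G ->
  measurable_fun setT k -> measurable_fun setT w -> (1 < q)%R ->
  (forall x, 0 <= w x <= 1)%R ->
  \int[mu]_(x in G) (`|k x| * w x)%:E <=
  mu G `^ (1 - q^-1) * (\int[mu]_(x in G) (`|k x| `^ q * w x)%:E) `^ q^-1.
Proof.
move=> mG mk mw q1 w01.
have q0 : (0 < q)%R by exact: lt_trans q1.
have qi : (0 < 1 - q^-1)%R by rewrite subr_gt0 invf_lt1.
pose f x : R := (k x * w x `^ q^-1 * \1_G x)%R.
have mind : measurable_fun setT (\1_G : T -> R) by exact: measurable_indic.
have mf : measurable_fun setT f.
  apply: measurable_funM => //; apply: measurable_funM => //.
  exact: (measurableT_comp (measurable_powR _)).
have := @hoelder _ _ _ mu f (\1_G) q (1 - q^-1)^-1 mf mind q0.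
rewrite invr_gt0 invrK => /(_ qi); rewrite subrKC => /(_ erefl) fG.
apply: (@le_trans _ _ ('N[mu]_1 [EFin \o (f \* \1_G)%R])).
  rewrite Lnorm1 integral_mkcond; apply: ge0_le_integral => //.
  - move=> x _; rewrite /patch; case: ifP => // _.
    by rewrite lee_fin mulr_ge0//; have /andP[] := w01 x.
  - apply: (measurable_restrictT _ _).1 => //.
    apply/measurable_EFinP/measurable_funTS.
    by apply: measurable_funM => //; exact: measurableT_comp.
  - by apply: measurableT_comp => //; apply/measurable_EFinP; exact: measurable_funM.
  - move=> x _; rewrite /patch /= /f indicE; case: ifPn => xG; last first.
      by rewrite lee_fin normr_ge0.
    have /andP[w0 w1] := w01 x.
    rewrite lee_fin !mulr1 normrM ler_wpM2l// ger0_norm ?powR_ge0//.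
    have [->|wn0] := eqVneq (w x) 0%R; first by rewrite powR_ge0.
    have wp : (0 < w x)%R by rewrite lt_neqAle eq_sym wn0.
    rewrite /powR gt_eqF// -[leLHS]lnK ?posrE// ler_expR.
    have := ln_le0 w1; have : (q^-1 < 1)%R by lra.
    by move=> ? ?; nra.
apply: (le_trans fG); rewrite muleC; apply: lee_pmul.
- exact: Lnorm_ge0.
- exact: Lnorm_ge0.
- rewrite unlock invrK; apply: gt0_ler_poweR; first exact: ltW.
  + by rewrite in_itv/= leey andbT integral_ge0// => x _;
      rewrite lee_fin powR_ge0.
  + by rewrite in_itv/= leey andbT.
  rewrite -[X in _ <= mu X]setIT -(integral_indic mu measurableT mG).
  rewrite le_eqVlt; apply/orP; left; apply/eqP; apply: eq_integral => x _.
  rewrite /= indicE; case: (x \in G) => /=.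
    by rewrite normr1 powR1.
  by rewrite normr0 powR0// invr_neq0// gt_eqF.
- rewrite unlock; apply: gt0_ler_poweR; first by rewrite invr_ge0 ltW.
  + by rewrite in_itv/= leey andbT integral_ge0// => x _;
      rewrite lee_fin powR_ge0.
  + rewrite in_itv/= leey andbT; apply: integral_ge0 => x _.
    by rewrite lee_fin mulr_ge0 ?powR_ge0//; have /andP[] := w01 x.
  rewrite [leRHS]integral_mkcond le_eqVlt; apply/orP; left; apply/eqP.
  apply: eq_integral => x _; rewrite /patch /= /f indicE.
  case: (x \in G) => /=; last first.
    by rewrite mulr0 normr0 powR0// gt_eqF.
  have /andP[w0 w1] := w01 x.
  rewrite mulr1 normrM powRM// (ger0_norm (powR_ge0 _ _)) -powRrM mulVf ?gt_eqF//.
  by rewrite powRr1.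
Qed.

Lemma le_integral_weight G k w : measurable G ->
  measurable_fun setT k -> measurable_fun setT w -> (forall x, 0 <= w x <= 1)%R ->
  \int[mu]_(x in G) (`|k x| * w x)%:E <= \int[mu]_(x in G) `|(k x)%:E|.
Proof.
move=> mG mk mw w01; apply: ge0_le_integral => //.
- by move=> x _; rewrite lee_fin mulr_ge0//; have /andP[] := w01 x.
- apply/measurable_EFinP; apply: measurable_funTS.
  by apply: measurable_funM => //; exact: measurableT_comp.
- apply/measurable_EFinP; apply: measurable_funTS; exact: measurableT_comp.
- by move=> x _; rewrite lee_fin ler_piMr//; have /andP[] := w01 x.
Qed.

Lemma hoelder_weighted_oo G k w : measurable G ->
  measurable_fun setT k -> measurable_fun setT w ->
  (forall x, 0 <= w x <= 1)%R ->
  \int[mu]_(x in G) (`|k x| * w x)%:E <= mu G * 'N[mu]_+oo [EFin \o (k \_ G)].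
Proof.
move=> mG mk mw w01.
have i0 x : G x -> 0 <= (`|k x| * w x)%:E.
  by rewrite lee_fin mulr_ge0//; have /andP[] := w01 x.
have mi : measurable_fun G (fun x => (`|k x| * w x)%:E).
  apply/measurable_EFinP/measurable_funTS.
  by apply: measurable_funM => //; exact: measurableT_comp.
rewrite unlock; case: ifPn => [mu0|]; last first.
  rewrite -leNgt => muT0.
  have muG0 : mu G = 0.
    apply/eqP; rewrite eq_le measure_ge0 andbT (le_trans _ muT0)//.
    by apply: le_measure => //; rewrite inE.
  by rewrite mule0 null_set_integral.
rewrite muleC -integral_cst//; apply: ae_ge0_le_integral => //.
- move=> x _; apply: ess_sup_gee => //; apply: nearW => y; exact: abse_ge0.
- have := ess_sup_ge mu (abse \o (EFin \o (k \_ G))).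
  apply: filterS => x /= + Gx; apply: le_trans.
  rewrite /patch mem_set//= lee_fin ler_piMr//.
  by have /andP[] := w01 x.
Qed.

(** Both integrals are finite: on [D] the hypothesis on [w - \1_D] reads
    [1 - w <= w], so that [w >= 1/2] and [|k| <= 2 |k| w] there. Their difference is
    then the integral of [k * (w - \1_D)]. *)
Lemma integral_diff_le Om D G k w :
  measurable Om -> measurable D -> measurable G -> D `<=` Om ->
  measurable_fun setT k -> measurable_fun setT w -> (forall x, 0 <= w x)%R ->
  (forall x, `|w x - \1_D x| <= w x * \1_G x)%R ->
  \int[mu]_x (`|k x| * w x)%:E < +oo ->
  let E := \int[mu]_(x in Om) (k x * w x)%:E - \int[mu]_(x in D) (k x)%:E in
  E \is a fin_num /\ `|E| <= \int[mu]_(x in G) (`|k x| * w x)%:E.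
Proof.
move=> mOm mD mG DOm mk mw w0 wDG kwoo E.
have ikw : mu.-integrable setT (EFin \o (fun x => k x * w x)%R).
  apply/integrableP; split; first by apply/measurable_EFinP; exact: measurable_funM.
  apply: le_lt_trans kwoo; rewrite le_eqVlt; apply/orP; left; apply/eqP.
  by apply: eq_integral => x _ /=; rewrite normrM (ger0_norm (w0 x)).
have w2 x : D x -> (1 / 2 <= w x)%R.
  move=> Dx; have := wDG x; rewrite indicE mem_set//= => h.
  have {h}: (`|w x - 1| <= w x)%R.
    by apply: le_trans h _; rewrite indicE; case: (_ \in _) => /=;
      rewrite ?mulr1 ?mulr0.
  by rewrite ler_norml; lra.
have ikD : mu.-integrable setT (EFin \o (fun x => k x * \1_D x)%R).
  have := integrableZl measurableT 2 ikw; apply: le_integrable => //.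
    by apply/measurable_EFinP; apply: measurable_funM.
  move=> x _; rewrite /= lee_fin indicE.
  have [Dx|nDx] := pselect (D x); last first.
    by rewrite memNset// mulr0 normr0.
  rewrite mem_set// mulr1 !normrM mulrCA -[leLHS]mulr1 ler_wpM2l//.
  by rewrite !ger0_norm//; have := w2 x Dx; lra.
have intD : \int[mu]_(x in D) (k x)%:E = \int[mu]_(x in Om) (k x * \1_D x)%:E.
  rewrite -[in LHS](setIidr DOm) integral_mkcondr; apply: eq_integral => x _.
  by rewrite /patch indicE; case: (x \in D); rewrite ?mulr1 ?mulr0.
have ikw' := integrableS measurableT mOm (@subsetT _ _) ikw.
have ikD' := integrableS measurableT mOm (@subsetT _ _) ikD.
have EE : E = \int[mu]_(x in Om) (k x * w x - k x * \1_D x)%:E.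
  by rewrite /E intD -integralB_EFin//.
split.
  rewrite EE; apply: integrable_fin_num => //.
  have := integrableB mOm ikw' ikD'.
  by apply: eq_integrable.
rewrite EE; apply: le_trans (le_abse_integral _ _ _) _ => //.
  apply/measurable_EFinP; apply: measurable_funB;
    apply: measurable_funTS; exact: measurable_funM.
have -> : \int[mu]_(x in G) (`|k x| * w x)%:E =
    \int[mu]_x (`|k x| * (w x * \1_G x))%:E.
  rewrite integral_mkcond; apply: eq_integral => x _.
  by rewrite /patch indicE; case: (x \in G); rewrite ?mulr1 ?mulr0.
have mkwG : measurable_fun setT (fun x => (`|k x| * (w x * \1_G x))%:E).
  apply/measurable_EFinP; apply: measurable_funM; first exact: measurableT_comp.
  exact: measurable_funM.
apply: (@le_trans _ _ (\int[mu]_(x in Om) (`|k x| * (w x * \1_G x))%:E)).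
  apply: ge0_le_integral => //.
  - apply: measurableT_comp => //; apply/measurable_EFinP; apply: measurable_funB;
    apply: measurable_funTS; exact: measurable_funM.
  - exact: measurable_funTS.
  - by move=> x _; rewrite /= lee_fin -mulrBr normrM ler_wpM2l.
apply: ge0_subset_integral => //.
by move=> x _; rewrite lee_fin !mulr_ge0.
Qed.

End core.

Lemma weighted_norm_patch {R : realType} {n} (p : \bar R) (U V : set 'rV[R]_n.+1)
    (w h : 'rV[R]_n.+1 -> R) : U `<=` V ->
  weighted_norm p U w (h \_ V) = weighted_norm p U w h.
Proof.
move=> UV; rewrite /weighted_norm; case: p => [q||].
- apply: (congr1 (poweR ^~ q^-1)); apply: eq_integral => x xU.
  by rewrite /patch mem_set//; apply: UV; rewrite -in_setE.
- by rewrite -patch_setI (setIidl UV).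
- by rewrite -patch_setI (setIidl UV).
Qed.

Lemma weighted_norm_ge0 {R : realType} {n} (p : \bar R) (U : set 'rV[R]_n.+1)
    (w v : 'rV[R]_n.+1 -> R) : (0 <= weighted_norm p U w v)%E.
Proof. by rewrite /weighted_norm; case: p => *; rewrite ?poweR_ge0 ?Lnorm_ge0. Qed.

Lemma weighted_norm_hoelder {R : realType} {n} (p : \bar R) (G : set 'rV[R]_n.+1)
    (w k : 'rV[R]_n.+1 -> R) : (1 < p)%E ->
  measurable (G : set (lebesgue_type R n)) ->
  measurable_fun [set: lebesgue_type R n] k ->
  measurable_fun [set: lebesgue_type R n] w ->
  (forall x, 0 <= w x <= 1) ->
  (\int[lebesgue]_(x in G) (`|k x| * w x)%:E <=
   lebesgue G `^ (1 - fine p^-1) * weighted_norm p G w k)%E.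
Proof.
move=> p1 mG mk mw w01; case: p p1 => [q||] // p1.
  rewrite lte_fin in p1; rewrite inver gt_eqF ?(lt_trans ltr01 p1)//=.
  exact: (@hoelder_weighted _ (lebesgue_type R n) R lebesgue G k w q).
rewrite invey /= subr0 poweRe1; last exact: lebesgue_outer_ge0.
exact: (@hoelder_weighted_oo _ (lebesgue_type R n) R lebesgue G k w).
Qed.

Lemma E_V_le {R : realType} {n} (D Omega : set 'rV[R]_n.+1) (S : R -> R)
    (eps : R) (k : 'rV[R]_n.+1 -> R) :
  open D -> D !=set0 -> ~` D !=set0 -> open Omega -> D `<=` Omega ->
  profile_S1 S -> profile_S2 S -> 0 < eps ->
  measurable_fun [set: lebesgue_type R n] k ->
  (\int[lebesgue]_(x in [set: lebesgue_type R n])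
     (`|k x| * omega S D eps x)%:E < +oo)%E ->
  E_V S D Omega eps k \is a fin_num /\
  (`|E_V S D Omega eps k| <=
    \int[lebesgue]_(x in (tube D eps : set (lebesgue_type R n)))
      (`|k x| * omega S D eps x)%:E)%E.
Proof.
move=> oD D0 CD0 oOm DOm S1 S2 e0 mk koo.
apply: (@integral_diff_le _ (lebesgue_type R n) R lebesgue Omega D (tube D eps)
  k (omega S D eps)) => //.
- exact: open_measurable_lebesgue.
- exact: open_measurable_lebesgue.
- exact: measurable_tube.
- by apply: measurable_omega => //; exact: profile_continuous.
- by move=> x; exact: omega_ge0.
- by move=> x; exact: omega_sub_indic.
Qed.

(** Allows [h], which is measurable only on the set where it matters, to be replaced
    by a function that is measurable everywhere. *)
Lemma E_V_patch {R : realType} {n} (D Omega V : set 'rV[R]_n.+1) (S : R -> R)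
    (eps : R) (h : 'rV[R]_n.+1 -> R) : D `<=` V ->
  (forall x, Omega x -> ~ V x -> omega S D eps x = 0) ->
  E_V S D Omega eps (h \_ V) = E_V S D Omega eps h.
Proof.
move=> DV w0; rewrite /E_V; congr (_ - _)%E;
  apply: eq_integral => x; rewrite inE => xA.
  rewrite /patch; case: ifPn => // /negP xV.
  by rewrite w0 ?mulr0// => Vx; apply: xV; rewrite inE.
by rewrite /patch mem_set//; exact: DV.
Qed.

(** * The error estimate *)

Theorem theorem5p1 (R : realType) (n : nat) (D Omega : set 'rV[R]_n.+1)
    (S : R -> R) (eps0 : R)
    (hD : domain D) (hDbd : bounded_set D) (hDbdry : C11_boundary D)
    (hOmega : domain Omega) (hDOmega : closure D `<=` Omega)
    (heps0 : small_radius D Omega eps0)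
    (hS1 : profile_S1 S) (hS2 : profile_S2 S) :
  (forall p : \bar R, (1 < p)%E ->
     exists C : R, 0 < C /\
       forall (eps : R) (h : 'rV[R]_n.+1 -> R),
         0 < eps <= eps0 ->
         in_weighted_Lp p (sublevel D eps) (omega S D eps) h ->
         (`|E_V S D Omega eps h| <=
            (C * eps `^ (1 - fine p^-1))%:E *
            weighted_norm p (tube D eps) (omega S D eps) h)%E) /\
  (forall h : 'rV[R]_n.+1 -> R,
     lebesgue.-integrable (Omega : set (lebesgue_type R n)) (EFin \o h) ->
     E_V S D Omega eps h @[eps --> 0^'+] --> 0%E).
Proof.
have [oD _ D0] := hD; have [oOm _ _] := hOmega.
have [eps0_gt0 _ _ _] := heps0.
have CD0 := bounded_setC D hDbd.
have DOm : D `<=` Omega := subset_trans (@subset_closure _ D) hDOmega.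
have [C C0 tubeC] := lebesgue_tube_le D eps0 oD hDbd hDbdry D0 CD0 eps0_gt0.
have mOm := open_measurable_lebesgue _ oOm.
have mw eps := measurable_omega D D0 CD0 S eps (profile_continuous S hS1).
have w01 eps x : 0 <= omega S D eps x <= 1 by rewrite omega_ge0// omega_le1.
split=> [p p1|h ih].
  have r0 : 0 <= 1 - fine p^-1.
    case: p p1 => [q||] //; last by rewrite invey subr0.
    rewrite lte_fin => q1; have q0 := lt_trans ltr01 q1.
    by rewrite inver gt_eqF//= subr_ge0 invf_le1 ?ltW.
  exists (C `^ (1 - fine p^-1)); split; first exact: powR_gt0.
  move=> eps h /andP[e0 ee0] [mh hoo].
  have mV := measurable_sublevel D D0 CD0 eps.
  set V := sublevel D eps in mh hoo mV.
  have DV : D `<=` V.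
    by move=> x Dx; exact: le_lt_trans (signed_dist_le0 D CD0 x Dx) e0.
  have tV : tube D eps `<=` V by move=> x [].
  (* cutting h off outside V, where the weight vanishes, makes it measurable *)
  rewrite -(E_V_patch D Omega V)//; last first.
    by move=> x _; exact: omega_eq0.
  rewrite -(weighted_norm_patch p (tube D eps) V)//.
  set k := h \_ V.
  have mk : measurable_fun [set: lebesgue_type R n] k.
    exact: (measurable_restrictT _ mV).1 mh.
  have koo : (\int[lebesgue]_(x in [set: lebesgue_type R n])
     (`|k x| * omega S D eps x)%:E < +oo)%E.
    have -> : (\int[lebesgue]_(x in [set: lebesgue_type R n])
         (`|k x| * omega S D eps x)%:E =
       \int[lebesgue]_(x in (V : set (lebesgue_type R n)))
         (`|k x| * omega S D eps x)%:E)%E.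
      rewrite [RHS]integral_mkcond; apply: eq_integral => x _.
      by rewrite /k /patch; case: (_ \in _) => //; rewrite normr0 mul0r.
    (* Hoelder's inequality on all of V, which has finite volume *)
    apply: le_lt_trans (weighted_norm_hoelder _ _ _ _ p1 mV mk (mw _) (w01 _)) _.
    rewrite weighted_norm_patch//.
    apply: lte_mul_pinfty => //; first exact: poweR_ge0.
    have : (lebesgue (V : set (lebesgue_type R n)) < +oo)%E.
      apply: lebesgue_outer_bounded; exact: bounded_sublevel.
    move=> Voo; rewrite ge0_fin_numE ?poweR_ge0//.
    exact: poweR_lty.
  have [_ EV] := E_V_le _ _ _ _ _ oD D0 CD0 oOm DOm hS1 hS2 e0 mk koo.
  apply: (le_trans EV).
  apply: le_trans (weighted_norm_hoelder _ _ _ _ p1 _ mk (mw _) (w01 _)) _.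
    exact: measurable_tube.
  apply: lee_wpmul2r; first exact: weighted_norm_ge0.
  rewrite -powRM ?(ltW C0) ?(ltW e0)// -poweR_EFin.
  apply: gt0_ler_poweR => //.
  - by rewrite in_itv/= leey andbT; exact: lebesgue_outer_ge0.
  - by rewrite in_itv/= leey andbT lee_fin mulr_ge0// ltW.
  - by apply: tubeC; rewrite e0.
pose k := h \_ Omega.
have ik : lebesgue.-integrable [set: lebesgue_type R n] (EFin \o k).
  rewrite (_ : EFin \o k = (EFin \o h) \_ Omega); last first.
    by apply/funext => x; rewrite /k /patch /=; case: (_ \in _).
  exact/(integrable_mkcond _ mOm).1.
have mk : measurable_fun [set: lebesgue_type R n] k.
  by apply/measurable_EFinP; case/integrableP : ik.
have koo eps : (\int[lebesgue]_(x in [set: lebesgue_type R n])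
     (`|k x| * omega S D eps x)%:E < +oo)%E.
  have /integrableP[_] := ik; apply: le_lt_trans.
  exact: (@le_integral_weight _ (lebesgue_type R n) R lebesgue setT k (omega S D eps)).
have Ek : E_V S D Omega ^~ h = E_V S D Omega ^~ k.
  by apply/funext => eps; rewrite E_V_patch.
rewrite Ek.
have bound eps : 0 < eps -> E_V S D Omega eps k \is a fin_num /\
   (`|E_V S D Omega eps k| <=
    \int[lebesgue]_(x in (tube D eps : set (lebesgue_type R n))) `|(k x)%:E|)%E.
  move=> e0.
  have [? EV] := E_V_le _ _ _ _ _ oD D0 CD0 oOm DOm hS1 hS2 e0 mk (koo eps).
  split=> //; apply: (le_trans EV).
  apply: (@le_integral_weight _ (lebesgue_type R n) R lebesgue _ k (omega S D eps)) => //.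
  exact: measurable_tube.
apply/fine_cvgP; split.
  by near=> eps; apply: (bound eps _).1; near: eps; exact: nbhs_right_gt.
apply/cvgr0Pnorm_lt => e e0.
(* absolute continuity: the integral of |k| over a set of volume < d is < e *)
have [d [d0 Hd]] := integral_normr_continuous ik e0.
near=> eps.
have eps_gt0 : 0 < eps by near: eps; exact: nbhs_right_gt.
have [fE EV] := bound eps eps_gt0.
have mt := measurable_tube D D0 CD0 eps.
have small : (lebesgue (tube D eps : set (lebesgue_type R n)) < d%:E)%E.
  apply: (@le_lt_trans _ _ (C * eps)%:E).
    by apply: tubeC; rewrite eps_gt0/=; near: eps; exact: nbhs_right_le.
  rewrite lte_fin mulrC -ltr_pdivlMr//; near: eps; apply: nbhs_right_lt.
  exact: divr_gt0.
apply: le_lt_trans (Hd _ mt small).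
rewrite -fine_abse// /Rintegral; apply: fine_le => //; first by rewrite abse_fin_num.
have := integrable_abse (integrableS measurableT mt (@subsetT _ _) ik).
exact: integrable_fin_num.
Unshelve. all: by end_near. Qed.
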